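(* For any non-degenerate triangle with side lengths $a,b,c$ and respective internal angle bisectors $l_a,l_b,l_c$, both of the following inequalities hold: \[ \sqrt{bc}\, l_a+ \sqrt{ac}\, l_b+\sqrt{ab}\, l_c \;\geq\; a\, l_a+ b\, l_b+c\, l_c \] and \[ (bc-a^2)\, l_a+ (ac-b^2)\, l_b+(ab-c^2)\, l_c \;\geq\; 0 . \]
   Context: $l_a,l_b,l_c$ denote the lengths of the internal angle bisectors drawn to the sides of lengths $a,b,c$ respectively, so $l_a=\dfrac{\sqrt{bc\,(a+b+c)(b+c-a)}}{b+c}$, $l_b=\dfrac{\sqrt{ac\,(a+b+c)(a+c-b)}}{a+c}$, $l_c=\dfrac{\sqrt{ab\,(a+b+c)(a+b-c)}}{a+b}$. Positive reals $a,b,c$ are the sides of a non-degenerate triangle iff $a+b>c$, $b+c>a$, $a+c>b$. *)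

(* Defs.v *)
From Stdlib Require Import Reals Lra.
Open Scope R_scope.

(* Lengths of the sides of a non-degenerate triangle. *)
Definition triangle_sides (a b c : R) : Prop :=
  0 < a /\ 0 < b /\ 0 < c /\ a + b > c /\ b + c > a /\ a + c > b.

(* Length of the internal bisector drawn to the side of length [x] in the
   triangle with sides [x], [y], [z]; symmetric in [y] and [z].  The lemma
   [bisector_geometric] below checks the formula against the geometry. *)
Definition bisector (x y z : R) : R :=
  sqrt (y * z * (x + y + z) * (y + z - x)) / (y + z).

(* Put the vertex opposite to the side [x] at the origin and the two others at
   [z u] and [y v], with [u] and [v] non-parallel unit vectors.  The foot [d]
   of the internal bisector is the point of the segment joining [z u] to [y v]
   that is a multiple of [u + v]. *)
Lemma bisector_geometric (ux uy vx vy x y z t k dx dy : R) :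
  ux ^ 2 + uy ^ 2 = 1 -> vx ^ 2 + vy ^ 2 = 1 -> ux * vy - uy * vx <> 0 ->
  0 < y -> 0 < z ->
  x = sqrt ((y * vx - z * ux) ^ 2 + (y * vy - z * uy) ^ 2) ->
  0 <= t <= 1 ->
  dx = (1 - t) * (z * ux) + t * (y * vx) ->
  dy = (1 - t) * (z * uy) + t * (y * vy) ->
  dx = k * (ux + vx) -> dy = k * (uy + vy) ->
  sqrt (dx ^ 2 + dy ^ 2) = bisector x y z.
Proof.
intros Hu Hv Huv Hy Hz Hx Ht Hdx Hdy Hkx Hky.
assert (Hx2 : x ^ 2 = (y * vx - z * ux) ^ 2 + (y * vy - z * uy) ^ 2).
{ rewrite Hx; apply pow2_sqrt, Rplus_le_le_0_compat; apply pow2_ge_0. }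
assert (Hk1 : (1 - t) * z = k).
{ apply Rminus_diag_uniq.
  apply (Rmult_eq_reg_r (ux * vy - uy * vx)); [|exact Huv].
  transitivity (vy * ((1 - t) * (z * ux) + t * (y * vx) - k * (ux + vx))
    - vx * ((1 - t) * (z * uy) + t * (y * vy) - k * (uy + vy))); [ring|].
  rewrite <- Hdx, <- Hdy, <- Hkx, <- Hky; ring. }
assert (Hk2 : t * y = k).
{ apply Rminus_diag_uniq.
  apply (Rmult_eq_reg_r (ux * vy - uy * vx)); [|exact Huv].
  transitivity (ux * ((1 - t) * (z * uy) + t * (y * vy) - k * (uy + vy))
    - uy * ((1 - t) * (z * ux) + t * (y * vx) - k * (ux + vx))); [ring|].
  rewrite <- Hdx, <- Hdy, <- Hkx, <- Hky; ring. }
assert (Hk : k * (y + z) = y * z).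
{ transitivity ((1 - t) * z * y + t * y * z); [rewrite Hk1, Hk2|]; ring. }
unfold bisector; apply (Rmult_eq_reg_r (y + z)); [|lra].
replace (sqrt (y * z * (x + y + z) * (y + z - x)) / (y + z) * (y + z))
  with (sqrt (y * z * (x + y + z) * (y + z - x))) by (field; lra).
rewrite <- (sqrt_pow2 (y + z)) at 1 by lra.
rewrite <- sqrt_mult_alt
  by (apply Rplus_le_le_0_compat; apply pow2_ge_0).
f_equal.
transitivity ((k * (y + z)) ^ 2 * ((ux + vx) ^ 2 + (uy + vy) ^ 2)).
{ rewrite Hkx, Hky; ring. }
rewrite Hk.
transitivity (y * z * ((y + z) ^ 2 - x ^ 2)); [|ring].
rewrite Hx2.
transitivity (y * z * (y * z * ((ux ^ 2 + uy ^ 2) + (vx ^ 2 + vy ^ 2)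
  + 2 * (ux * vx + uy * vy)))); [ring|].
transitivity (y * z * ((y + z) ^ 2 - (y ^ 2 * (vx ^ 2 + vy ^ 2)
  + z ^ 2 * (ux ^ 2 + uy ^ 2) - 2 * y * z * (ux * vx + uy * vy)))); [|ring].
rewrite Hu, Hv; ring.
Qed.

(* Main.v *)
Require Import Defs.
From Stdlib Require Import Reals Lra.
Open Scope R_scope.

(** For all [p], [q], [r] the sum of [(q r - p^2) (q + r)] over the cyclic
    shifts vanishes, so [sum (q r - p^2) (q + r) g_p] is a combination of the
    products [(p - q) (g_q - g_p)] with nonnegative coefficients [r (p + q)].
    The second inequality is the case [(p, q, r) = (a, b, c)] with
    [g_a = l_a / (b + c)], the first one the case of the square roots
    [(sqrt a, sqrt b, sqrt c)] with [g_a = l_a / (sqrt b + sqrt c)]. In both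
    cases the larger side has the smaller [g]. *)

Lemma weighted_sum_nonneg (p q r l1 l2 l3 : R) :
  0 < p -> 0 < q -> 0 < r ->
  0 <= (p - q) * (l2 / (p + r) - l1 / (q + r)) ->
  0 <= (q - r) * (l3 / (p + q) - l2 / (p + r)) ->
  0 <= (p - r) * (l3 / (p + q) - l1 / (q + r)) ->
  0 <= (q * r - p ^ 2) * l1 + (p * r - q ^ 2) * l2 + (p * q - r ^ 2) * l3.
Proof.
intros Hp Hq Hr H12 H23 H13.
replace ((q * r - p ^ 2) * l1 + (p * r - q ^ 2) * l2 + (p * q - r ^ 2) * l3)
  with (r * (p + q) * ((p - q) * (l2 / (p + r) - l1 / (q + r)))
    + p * (q + r) * ((q - r) * (l3 / (p + q) - l2 / (p + r)))
    + q * (p + r) * ((p - r) * (l3 / (p + q) - l1 / (q + r))))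
  by (field; lra).
repeat apply Rplus_le_le_0_compat; apply Rmult_le_pos; trivial; nra.
Qed.

(** Clearing denominators and writing [u] and [v] as roots of their squares leaves a comparison of
    two radicands, so inequalities between bisectors become polynomial ones. *)
Lemma sqrt_div_le (A B u v : R) :
  0 < u -> 0 < v -> 0 <= A -> A * v ^ 2 <= B * u ^ 2 ->
  sqrt A / u <= sqrt B / v.
Proof.
intros Hu Hv HA H.
apply (Rmult_le_reg_r (u * v)); [nra|].
replace (sqrt A / u * (u * v)) with (sqrt A * v) by (field; lra).
replace (sqrt B / v * (u * v)) with (sqrt B * u) by (field; lra).
rewrite <- (sqrt_pow2 v), <- (sqrt_pow2 u) by lra.
rewrite <- !sqrt_mult_alt; [now apply sqrt_le_1_alt| |exact HA].
(* The goal left is [0 <= B]: it follows from [0 <= A * v ^ 2 <= B * u ^ 2] and [0 < u ^ 2]. *)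
assert (0 < u ^ 2) by nra.
assert (0 <= A * v ^ 2) by (apply Rmult_le_pos; [exact HA|apply pow2_ge_0]).
nra.
Qed.

Lemma triangle_sides_swap (x y z : R) :
  triangle_sides x y z -> triangle_sides y x z.
Proof. unfold triangle_sides; intuition lra. Qed.

Lemma triangle_sides_rot (x y z : R) :
  triangle_sides x y z -> triangle_sides y z x.
Proof. unfold triangle_sides; intuition lra. Qed.

Lemma bisector_sym (x y z : R) : bisector x y z = bisector x z y.
Proof.
unfold bisector; rewrite (Rplus_comm z y); do 2 f_equal; ring.
Qed.

(** After squaring and cross-multiplying, both sides share the factor [z * (x + y + z)]; what
    remains is the product of the two inequalities [Hcross] and [Hcube] between nonnegative
    quantities. *)
Lemma bisector_div_sum_le (x y z : R) : triangle_sides x y z -> y <= x ->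
  bisector x y z / (y + z) <= bisector y x z / (x + z).
Proof.
intros (Hx & Hy & Hz & Hxy & Hyz & Hxz) Hle; unfold bisector.
replace (sqrt (y * z * (x + y + z) * (y + z - x)) / (y + z) / (y + z))
  with (sqrt (y * z * (x + y + z) * (y + z - x)) / (y + z) ^ 2)
  by (field; lra).
replace (sqrt (x * z * (y + x + z) * (x + z - y)) / (x + z) / (x + z))
  with (sqrt (x * z * (y + x + z) * (x + z - y)) / (x + z) ^ 2)
  by (field; lra).
apply sqrt_div_le; [nra|nra| |].
{ repeat apply Rmult_le_pos; lra. }
assert (Hcross : 0 <= y * (x + z) <= x * (y + z)) by nra.
assert (Hcube : 0 <= (y + z - x) * (x + z) ^ 3
                  <= (x + z - y) * (y + z) ^ 3).
{ split; [apply Rmult_le_pos; [lra|apply pow_le; lra]|].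
  apply Rge_le, Rminus_ge, Rle_ge.
  (* The difference vanishes at [x = y]. In the cofactor of [x - y], the first term is nonnegative
     since [y <= x], the second since [z < x + y]. *)
  replace ((x + z - y) * (y + z) ^ 3 - (y + z - x) * (x + z) ^ 3)
    with ((x - y) * ((x - y) * (x * (x + z) - y * (y + z))
      + (x + y - z) * ((x + z) * (y + z)))) by ring.
  apply Rmult_le_pos; [lra|].
  apply Rplus_le_le_0_compat; apply Rmult_le_pos; nra. }
replace (y * z * (x + y + z) * (y + z - x) * ((x + z) ^ 2) ^ 2)
  with (z * (x + y + z) * (y * (x + z) * ((y + z - x) * (x + z) ^ 3))) by ring.
replace (x * z * (y + x + z) * (x + z - y) * ((y + z) ^ 2) ^ 2)
  with (z * (x + y + z) * (x * (y + z) * ((x + z - y) * (y + z) ^ 3))) by ring.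
apply Rmult_le_compat_l; [nra|].
apply Rmult_le_compat; tauto.
Qed.

(** The same splitting into two factors works here: [Hcross] takes the sums of square roots and
    [Hsquare] the sums of sides. *)
Lemma bisector_div_sqrt_sum_le (x y z : R) : triangle_sides x y z -> y <= x ->
  bisector x y z / (sqrt y + sqrt z) <= bisector y x z / (sqrt x + sqrt z).
Proof.
intros (Hx & Hy & Hz & Hxy & Hyz & Hxz) Hle; unfold bisector.
pose proof (sqrt_lt_R0 x Hx) as Hsx.
pose proof (sqrt_lt_R0 y Hy) as Hsy.
pose proof (sqrt_lt_R0 z Hz) as Hsz.
pose proof (sqrt_le_1_alt y x Hle) as Hsle.
pose proof (pow2_sqrt x (Rlt_le _ _ Hx)) as Ex.
pose proof (pow2_sqrt y (Rlt_le _ _ Hy)) as Ey.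
set (p := sqrt x) in *; set (q := sqrt y) in *; set (r := sqrt z) in *.
replace (sqrt (y * z * (x + y + z) * (y + z - x)) / (y + z) / (q + r))
  with (sqrt (y * z * (x + y + z) * (y + z - x)) / ((y + z) * (q + r)))
  by (field; lra).
replace (sqrt (x * z * (y + x + z) * (x + z - y)) / (x + z) / (p + r))
  with (sqrt (x * z * (y + x + z) * (x + z - y)) / ((x + z) * (p + r)))
  by (field; lra).
apply sqrt_div_le; [nra|nra| |].
{ repeat apply Rmult_le_pos; lra. }
assert (Hcross : 0 <= y * (p + r) ^ 2 <= x * (q + r) ^ 2).
(* With [x = p ^ 2] and [y = q ^ 2] both bounds are squares, and [q * (p + r) <= p * (q + r)]
   amounts to [q * r <= p * r]. *)
{ rewrite <- Ex, <- Ey, <- !Rpow_mult_distr.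
  split; [apply pow2_ge_0|apply pow_incr; nra]. }
assert (Hsquare : 0 <= (y + z - x) * (x + z) ^ 2
                    <= (x + z - y) * (y + z) ^ 2).
{ split; [apply Rmult_le_pos; [lra|apply pow2_ge_0]|].
  apply Rge_le, Rminus_ge, Rle_ge.
  replace ((x + z - y) * (y + z) ^ 2 - (y + z - x) * (x + z) ^ 2)
    with ((x - y) * (x ^ 2 + y ^ 2 + z * (x + y))) by ring.
  apply Rmult_le_pos; nra. }
replace (y * z * (x + y + z) * (y + z - x) * ((x + z) * (p + r)) ^ 2)
  with (z * (x + y + z) * (y * (p + r) ^ 2 * ((y + z - x) * (x + z) ^ 2)))
  by ring.
replace (x * z * (y + x + z) * (x + z - y) * ((y + z) * (q + r)) ^ 2)
  with (z * (x + y + z) * (x * (q + r) ^ 2 * ((x + z - y) * (y + z) ^ 2)))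
  by ring.
apply Rmult_le_compat_l; [nra|].
apply Rmult_le_compat; tauto.
Qed.

(** Exchanging [x] and [y] changes the sign of both factors, so the ordered case suffices. *)
Lemma bisector_div_sum_antitone (x y z : R) : triangle_sides x y z ->
  0 <= (x - y) * (bisector y x z / (x + z) - bisector x y z / (y + z)).
Proof.
intros H; destruct (Rle_or_lt y x) as [Hle | Hlt].
- pose proof (bisector_div_sum_le x y z H Hle); nra.
- pose proof (bisector_div_sum_le y x z (triangle_sides_swap _ _ _ H)
    (Rlt_le _ _ Hlt)); nra.
Qed.

Lemma bisector_div_sqrt_sum_antitone (x y z : R) : triangle_sides x y z ->
  0 <= (sqrt x - sqrt y) * (bisector y x z / (sqrt x + sqrt z)
                            - bisector x y z / (sqrt y + sqrt z)).
Proof.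
intros H; destruct (Rle_or_lt y x) as [Hle | Hlt].
- pose proof (sqrt_le_1_alt y x Hle).
  pose proof (bisector_div_sqrt_sum_le x y z H Hle); nra.
- pose proof (sqrt_le_1_alt x y (Rlt_le _ _ Hlt)).
  pose proof (bisector_div_sqrt_sum_le y x z (triangle_sides_swap _ _ _ H)
    (Rlt_le _ _ Hlt)); nra.
Qed.

Theorem mainTheorem3 (a b c : R) (Habc : triangle_sides a b c) :
  let la := bisector a b c in
  let lb := bisector b a c in
  let lc := bisector c a b in
  sqrt (b * c) * la + sqrt (a * c) * lb + sqrt (a * b) * lc
    >= a * la + b * lb + c * lc
  /\
  (b * c - a ^ 2) * la + (a * c - b ^ 2) * lb + (a * b - c ^ 2) * lc >= 0.
Proof.
intros la lb lc.
assert (Hbca := triangle_sides_rot _ _ _ Habc).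
assert (Hacb := triangle_sides_swap _ _ _ (triangle_sides_rot _ _ _ Hbca)).
pose proof Habc as (Ha & Hb & Hc & _).
split; apply Rle_ge.
- pose proof (bisector_div_sqrt_sum_antitone a b c Habc) as H12.
  pose proof (bisector_div_sqrt_sum_antitone b c a Hbca) as H23.
  pose proof (bisector_div_sqrt_sum_antitone a c b Hacb) as H13.
  (* Symmetry of the bisector and of the sums brings the permuted instances to the form that
     [weighted_sum_nonneg] expects. *)
  rewrite (bisector_sym c b a), (bisector_sym b c a),
    (Rplus_comm (sqrt b) (sqrt a)), (Rplus_comm (sqrt c) (sqrt a)) in H23.
  rewrite (bisector_sym a c b), (Rplus_comm (sqrt c) (sqrt b)) in H13.
  pose proof (weighted_sum_nonneg (sqrt a) (sqrt b) (sqrt c) la lb lc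
    (sqrt_lt_R0 a Ha) (sqrt_lt_R0 b Hb) (sqrt_lt_R0 c Hc) H12 H23 H13) as H.
  (* Since [sqrt b * sqrt c = sqrt (b * c)] and [sqrt a ^ 2 = a], and likewise for the other sides,
     the sum in [H] is the difference of the two sides of the goal. *)
  rewrite !pow2_sqrt in H by lra.
  rewrite !sqrt_mult by lra; lra.
- pose proof (bisector_div_sum_antitone a b c Habc) as H12.
  pose proof (bisector_div_sum_antitone b c a Hbca) as H23.
  pose proof (bisector_div_sum_antitone a c b Hacb) as H13.
  rewrite (bisector_sym c b a), (bisector_sym b c a),
    (Rplus_comm b a), (Rplus_comm c a) in H23.
  rewrite (bisector_sym a c b), (Rplus_comm c b) in H13.
  exact (weighted_sum_nonneg a b c la lb lc Ha Hb Hc H12 H23 H13).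
Qed.
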